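(* Let $x,y\in\mathcal{R}^{(2)}$ and $a\in\mathcal{R}$. Then: (i) $\|x\|\ge 0$, with equality only when $x=0$. (ii) $\|ax\|=|a|\,\|x\|$, where $|a|$ denotes the absolute value of the real number $a$. (iii) $\|x+y\|\le\|x\|+\|y\|$. (iv) $\|xy\|\le\|x\|\,\|y\|$.
   Context: $\mathcal{R}$ is the field of real numbers. The dual real number algebra $\mathcal{R}^{(2)}$ is the real vector space $\mathcal{R}^2$ with the multiplication $(x_1,x_2)\cdot(y_1,y_2)=(x_1y_1,\,x_1y_2+x_2y_1)$. For $x=(x_1,x_2)\in\mathcal{R}^{(2)}$ put $Re\,x:=x_1$ and $Ze\,x:=x_2$. The norm $\|\cdot\|:\mathcal{R}^{(2)}\to\mathcal{R}$ is defined by $\|x\|:=\sqrt{2(Re\,x)^2+(Ze\,x)^2}$. *)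

(* Defs.v *)
From HB Require Import structures.
From mathcomp Require Import all_boot all_order all_algebra.
From mathcomp Require Import reals.

Set Implicit Arguments.
Unset Strict Implicit.
Unset Printing Implicit Defensive.

Import Order.TTheory GRing.Theory Num.Theory.

Local Open Scope ring_scope.

(* A record rather than an alias of [R * R]: the library's canonical product on
   [R * R] is the componentwise one, and an alias leaks it through unification,
   e.g. in [(a *: x) * y]. *)
Record dual (R : realType) : Type := Dual { Re : R; Ze : R }.

Definition pair_of_dual (R : realType) (x : dual R) : R * R := (Re x, Ze x).
Definition dual_of_pair (R : realType) (p : R * R) : dual R := Dual p.1 p.2.

Fact pair_of_dualK (R : realType) :
  cancel (@pair_of_dual R) (@dual_of_pair R).
Proof. by case. Qed.

HB.instance Definition _ (R : realType) :=
  Choice.copy (dual R) (can_type (@pair_of_dualK R)).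

Definition dual_zero (R : realType) : dual R := Dual 0 0.
Definition dual_opp (R : realType) (x : dual R) : dual R :=
  Dual (- Re x) (- Ze x).
Definition dual_add (R : realType) (x y : dual R) : dual R :=
  Dual (Re x + Re y) (Ze x + Ze y).

Fact dual_addA (R : realType) : associative (@dual_add R).
Proof. by move=> x y z; rewrite /dual_add /= !addrA. Qed.

Fact dual_addC (R : realType) : commutative (@dual_add R).
Proof. by move=> x y; rewrite /dual_add addrC [Ze x + _]addrC. Qed.

Fact dual_add0 (R : realType) : left_id (@dual_zero R) (@dual_add R).
Proof. by case=> a b; rewrite /dual_add /= !add0r. Qed.

Fact dual_addN (R : realType) :
  left_inverse (@dual_zero R) (@dual_opp R) (@dual_add R).
Proof. by move=> x; rewrite /dual_add /= !addNr. Qed.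

HB.instance Definition _ (R : realType) :=
  GRing.isZmodule.Build (dual R)
    (@dual_addA R) (@dual_addC R) (@dual_add0 R) (@dual_addN R).

Definition dual_one (R : realType) : dual R := Dual 1 0.
Definition dual_mul (R : realType) (x y : dual R) : dual R :=
  Dual (Re x * Re y) (Re x * Ze y + Ze x * Re y).

Fact dual_mulA (R : realType) : associative (@dual_mul R).
Proof.
by move=> x y z; rewrite /dual_mul /= mulrDr mulrDl !mulrA addrA.
Qed.

Fact dual_mulC (R : realType) : commutative (@dual_mul R).
Proof.
move=> x y; rewrite /dual_mul (mulrC (Re x) (Re y)) addrC.
by rewrite (mulrC (Ze x)) (mulrC (Re x)).
Qed.

Fact dual_mul1 (R : realType) : left_id (@dual_one R) (@dual_mul R).
Proof. by case=> a b; rewrite /dual_mul /= !mul1r mul0r addr0. Qed.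

Fact dual_mulDl (R : realType) : left_distributive (@dual_mul R) +%R.
Proof.
by move=> x y z; congr Dual; rewrite /= !mulrDl // addrACA.
Qed.

Fact dual_one_neq0 (R : realType) : @dual_one R != 0.
Proof. by apply/eqP => -[] /eqP; rewrite oner_eq0. Qed.

HB.instance Definition _ (R : realType) :=
  GRing.Zmodule_isComNzRing.Build (dual R)
    (@dual_mulA R) (@dual_mulC R) (@dual_mul1 R) (@dual_mulDl R)
    (@dual_one_neq0 R).

Definition dual_scale (R : realType) (a : R) (x : dual R) : dual R :=
  Dual (a * Re x) (a * Ze x).

Fact dual_scaleA (R : realType) (a b : R) (x : dual R) :
  dual_scale a (dual_scale b x) = dual_scale (a * b) x.
Proof. by rewrite /dual_scale /= !mulrA. Qed.

Fact dual_scale1 (R : realType) : left_id 1 (@dual_scale R).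
Proof. by case=> a b; rewrite /dual_scale /= !mul1r. Qed.

Fact dual_scaleDr (R : realType) : right_distributive (@dual_scale R) +%R.
Proof. by move=> a x y; congr Dual; rewrite /= mulrDr. Qed.

Fact dual_scaleDl (R : realType) (x : dual R) :
  {morph (@dual_scale R)^~ x : a b / a + b}.
Proof. by move=> a b; congr Dual; rewrite /= mulrDl. Qed.

HB.instance Definition _ (R : realType) :=
  GRing.Zmodule_isLmodule.Build R (dual R)
    (@dual_scaleA R) (@dual_scale1 R) (@dual_scaleDr R) (@dual_scaleDl R).

Fact dual_scaleAl (R : realType) (a : R) (x y : dual R) :
  a *: (x * y) = (a *: x) * y.
Proof. by congr Dual; rewrite /= ?mulrDr !mulrA. Qed.

HB.instance Definition _ (R : realType) :=
  GRing.Lmodule_isLalgebra.Build R (dual R) (@dual_scaleAl R).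

Fact dual_scaleAr (R : realType) (a : R) (x y : dual R) :
  a *: (x * y) = x * (a *: y).
Proof. by rewrite mulrC dual_scaleAl mulrC. Qed.

HB.instance Definition _ (R : realType) :=
  GRing.Lalgebra_isAlgebra.Build R (dual R) (@dual_scaleAr R).

Definition dual_norm (R : realType) (x : dual R) : R :=
  Num.sqrt (2 * Re x ^+ 2 + Ze x ^+ 2).

(* Main.v *)
Require Import Defs.
From mathcomp Require Import all_boot all_order all_algebra.
From mathcomp Require Import reals.
From mathcomp Require Import ring.

Import Order.TTheory GRing.Theory Num.Theory.
(* So that [Re] is the projection of [dual], not the real part of a complex
   number. *)
Import Defs.

Local Open Scope ring_scope.

(** [dual_norm] is the Euclidean norm of the vector (sqrt 2 * [Re x], [Ze x]). Hence (i) and (ii)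
    are immediate, and (iii) follows from Cauchy-Schwarz, [dual_inner_le_norm]. For (iv), both sides
    are nonnegative and the difference of their squares is a sum of squares. *)

Lemma dual_sqnorm_ge0 (R : realType) (x : dual R) :
  0 <= 2 * Re x ^+ 2 + Ze x ^+ 2.
Proof. by rewrite addr_ge0 ?sqr_ge0 // mulr_ge0 ?sqr_ge0. Qed.

Lemma dual_norm_ge0 (R : realType) (x : dual R) : 0 <= dual_norm x.
Proof. exact: sqrtr_ge0. Qed.

Lemma sqr_dual_norm (R : realType) (x : dual R) :
  dual_norm x ^+ 2 = 2 * Re x ^+ 2 + Ze x ^+ 2.
Proof. by rewrite sqr_sqrtr ?dual_sqnorm_ge0. Qed.

Lemma dual_norm_eq0 (R : realType) (x : dual R) : dual_norm x = 0 -> x = 0.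
Proof.
move=> nx0; have /eqP := sqr_dual_norm _ x.
rewrite nx0 expr0n eq_sym paddr_eq0 ?sqr_ge0 //; last by rewrite mulr_ge0 ?sqr_ge0.
rewrite mulf_eq0 pnatr_eq0 !sqrf_eq0 /= => /andP[/eqP rex0 /eqP zex0].
by case: x rex0 zex0 {nx0} => p q /= -> ->.
Qed.

Lemma dual_normZ (R : realType) (a : R) (x : dual R) :
  dual_norm (a *: x) = `|a| * dual_norm x.
Proof.
(* With [|a|] written as the square root of [a ^+ 2], both sides are single roots and only their
   radicands need comparing. *)
rewrite -sqrtr_sqr -sqrtrM ?sqr_ge0 //; congr Num.sqrt => /=; ring.
Qed.

(* Cauchy-Schwarz, with defect [2 (Re x Ze y - Ze x Re y)^2]. *)
Lemma dual_inner_le_norm (R : realType) (x y : dual R) :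
  2 * (Re x * Re y) + Ze x * Ze y <= dual_norm x * dual_norm y.
Proof.
(* The inner product may be negative, so it is bounded by its absolute value before squaring. *)
rewrite (le_trans (ler_norm _)) // -ler_sqr ?nnegrE ?normr_ge0 //; last first.
  by rewrite mulr_ge0 ?dual_norm_ge0.
rewrite real_normK ?num_real // exprMn !sqr_dual_norm -subr_ge0.
rewrite (_ : _ - _ = 2 * (Re x * Ze y - Ze x * Re y) ^+ 2); last by ring.
by rewrite mulr_ge0 ?sqr_ge0.
Qed.

Lemma ler_dual_normD (R : realType) (x y : dual R) :
  dual_norm (x + y) <= dual_norm x + dual_norm y.
Proof.
rewrite -ler_sqr ?nnegrE ?addr_ge0 ?dual_norm_ge0 //.
rewrite sqrrD !sqr_dual_norm -subr_ge0 /=.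
(* The squared norms cancel, leaving twice the gap in Cauchy-Schwarz. *)
rewrite (_ : _ - _ = 2 * (dual_norm x * dual_norm y -
                          (2 * (Re x * Re y) + Ze x * Ze y))); last by ring.
by rewrite mulr_ge0 // subr_ge0 dual_inner_le_norm.
Qed.

(** The weight 2 on [Re] is what makes this work: it doubles the mixed squares in the product of the
    squared norms, enough to absorb the cross term of [Ze (x * y) ^+ 2] into a perfect square. *)
Lemma ler_dual_normM (R : realType) (x y : dual R) :
  dual_norm (x * y) <= dual_norm x * dual_norm y.
Proof.
rewrite -ler_sqr ?nnegrE ?mulr_ge0 ?dual_norm_ge0 //.
rewrite exprMn !sqr_dual_norm -subr_ge0 /=.
rewrite (_ : _ - _ = 2 * (Re x * Re y) ^+ 2 + (Ze x * Ze y) ^+ 2 +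
                     (Re x * Ze y - Ze x * Re y) ^+ 2); last by ring.
by rewrite !addr_ge0 ?sqr_ge0 // mulr_ge0 ?sqr_ge0.
Qed.

Theorem proposition1p1 (R : realType) (x y : dual R) (a : R) :
  (0 <= dual_norm x /\ (dual_norm x = 0 -> x = 0)) /\
  dual_norm (a *: x) = `|a| * dual_norm x /\
  dual_norm (x + y) <= dual_norm x + dual_norm y /\
  dual_norm (x * y) <= dual_norm x * dual_norm y.
Proof.
split; first by split; [exact: dual_norm_ge0 | exact: dual_norm_eq0].
split; first exact: dual_normZ.
by split; [exact: ler_dual_normD | exact: ler_dual_normM].
Qed.
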